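(* Let $I=(i_1,\dots,i_k)$ be a composition of a positive integer $m$, and let $n$ and $a$ be non-negative integers with $n\ge m$ and $n>a$. Then $$n(n+1)\,P^I_{n+1,a+1}=(n-m+1)(n+m)\,P^I_{n,a}+\sum_{h=1}^k i_h(i_h-1)\,P^{I-\delta_h}_{n,a}.$$
   Context: Let $I=(i_1,\dots,i_k)$ be a composition of $m$ (positive parts) and let $J=(J_1,\dots,J_k)$ be the set partition of $[m]$ into consecutive blocks with $|J_p|=i_p$, i.e. $J_p=\{i_1+\dots+i_{p-1}+1,\dots,i_1+\dots+i_p\}$. For $n\ge m$, a permutation $\sigma\in\mathfrak{S}_n$ is strongly $I$-separated if no cycle of $\sigma$ contains two elements from different blocks of $J$ and, moreover, each block $J_p$ is contained in a single cycle of $\sigma$. For $0\le a<n$, $P^I_{n,a}$ is the probability that $\alpha\beta$ is strongly $I$-separated, where $\alpha$ and $\beta$ are independent, $\alpha$ uniformly distributed among the $n$-cycles of $\mathfrak{S}_n$ and $\beta$ uniformly distributed among permutations of cycle type $(n-a,1^a)$. $I-\delta_h$ is the composition obtained from $I$ by replacing $i_h$ by $i_h-1$; when $i_h=1$ the corresponding term in the sum is $0$. *)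

(* Defs.v *)
From mathcomp Require Import all_boot all_order all_algebra all_fingroup.

Set Implicit Arguments.
Unset Strict Implicit.
Unset Printing Implicit Defensive.

Import GroupScope.

Definition composition_of (m : nat) (I : seq nat) : bool :=
  all (leq 1) I && (sumn I == m).

(* I - delta_h, with h counted from 0; if the h-th part is 1 the result has a
   zero part and is no longer a composition. *)
Definition decr_part (I : seq nat) (h : nat) : seq nat :=
  set_nth 0 I h (nth 0 I h).-1.

(* The ground set [n] is 'I_n, so element i of [n] is the ordinal of value
   i - 1, and the blocks are indexed from 0.  The intended use is sumn I <= n;
   otherwise the blocks are truncated. *)
Definition block (n : nat) (I : seq nat) (p : nat) : {set 'I_n} :=
  [set x : 'I_n | sumn (take p I) <= x < sumn (take p.+1 I)].

(* porbits s contains the singletons of the fixed points of s, i.e. 1-cycles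
   count as cycles. *)
Definition separated (n : nat) (I : seq nat) (s : 'S_n) : bool :=
  [forall C in porbits s, forall p : 'I_(size I), forall q : 'I_(size I),
     (C :&: block n I p != set0) && (C :&: block n I q != set0) ==> (p == q)].

Definition strongly_separated (n : nat) (I : seq nat) (s : 'S_n) : bool :=
  separated I s &&
  [forall p : 'I_(size I), exists C in porbits s, block n I p \subset C].

Definition has_cycle_type (n : nat) (lambda : seq nat) (s : 'S_n) : bool :=
  perm_eq [seq #|C| | C : {set 'I_n} <- enum (porbits s)] lambda.

Definition cycle_class (n : nat) (lambda : seq nat) : {set 'S_n} :=
  [set s : 'S_n | has_cycle_type lambda s].

(* Two independent uniform choices in A and B amount to one uniform choice in
   A x B.  The product u.1 * u.2 applies u.1 first; the opposite convention gives
   the same probability, since inversion preserves A, B and the cycles. *)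
Definition prob_strongly_separated (n a : nat) (I : seq nat) : rat :=
  let A := cycle_class n [:: n] in
  let B := cycle_class n ((n - a)%N :: nseq a 1%N) in
  (#|[set u in setX A B | strongly_separated I (u.1 * u.2)]|%:R
     / #|setX A B|%:R)%R.

(* Main.v *)
Require Import Defs.
From mathcomp Require Import all_boot all_order all_algebra all_fingroup.
From mathcomp Require Import ring.
Set Implicit Arguments.
Unset Strict Implicit.
Unset Printing Implicit Defensive.

Import Order.TTheory GRing.Theory Num.Theory.
Local Open Scope ring_scope.

(** Count the triples (x, alpha, beta) with alpha, beta in S_(n+1) of the
    prescribed cycle types, alpha * beta strongly I-separated and x a fixed
    point of beta.  All beta have the same number of fixed points, so this is
    a multiple of the numerator of P^I_(n+1,a+1).  Deleting x from alpha and
    beta leaves a pair (alpha', beta') counted by P_(n,a), and the triple is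
    recovered from x, this pair and the predecessor u of x in alpha; moreover
    alpha * beta arises from alpha' * beta' by inserting x after u in the same
    way.  If x lies in no block, u is arbitrary and the count is that for I.
    If x lies in the block h, then either u is one of the i_h - 1 other
    elements of that block, which gives the count for I - delta_h, or u is one
    of the n + 1 - m elements outside all blocks, in which case u takes over
    the role of x and the count is again that for I. *)

(** * Orbits and cycle types under maps and conjugation *)

(** One step of [s] only has to stay inside an orbit of [t]. This weak form suits [collapse] and
    [lift x], under which one step may become zero or two. *)
Lemma homo_porbit (T T' : finType) (f : T -> T') (s : {perm T})
    (t : {perm T'}) :
  (forall x, f (s x) \in porbit t (f x)) ->
  forall x y, y \in porbit s x -> f y \in porbit t (f x).
Proof.
move=> fst x _ /porbitP[i ->]; elim: i => [|i IHi].
  by rewrite expg0 perm1 porbit_id.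
rewrite expgSr permM; move: (fst ((s ^+ i)%g x)).
by move: IHi; rewrite -!eq_porbit_mem => /eqP-> .
Qed.

Lemma porbit_imset (T T' : finType) (f : T -> T') (s : {perm T})
    (t : {perm T'}) :
  (forall x, f (s x) = t (f x)) ->
  forall x, porbit t (f x) = f @: porbit s x.
Proof.
move=> fst x; have iterE i : (t ^+ i)%g (f x) = f ((s ^+ i)%g x).
  by elim: i => [|i IHi]; rewrite ?expg0 ?perm1 // !expgSr !permM IHi fst.
apply/setP=> y; apply/porbitP/imsetP => [[i ->]|[_ /porbitP[i ->] ->]].
  by exists ((s ^+ i)%g x); rewrite ?mem_porbit.
by exists i.
Qed.

(** On [porbits s] this is the list that [has_cycle_type] compares with [lambda]. *)
Definition orbit_sizes (T : finType) (S : {set {set T}}) : seq nat :=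
  [seq #|C| | C : {set T} <- enum S].

Lemma orbit_sizes_imset (T T' : finType) (f : T -> T') (S : {set {set T}}) :
  injective f ->
  perm_eq (orbit_sizes [set f @: C | C : {set T} in S]) (orbit_sizes S).
Proof.
move=> f_inj; rewrite /orbit_sizes.
have fS_inj : injective (fun C : {set T} => f @: C) by apply: imset_inj.
have /(perm_map (fun C : {set T'} => #|C|)) :
    perm_eq (enum [set f @: C | C : {set T} in S])
            [seq f @: C | C : {set T} <- enum S].
  apply: uniq_perm; rewrite ?(map_inj_uniq fS_inj) ?enum_uniq // => C.
  rewrite mem_enum; apply/imsetP/mapP => -[D DS ->]; exists D => //.
    by rewrite mem_enum.
  by rewrite -mem_enum.
rewrite -map_comp (eq_map (g := fun C : {set T} => #|C|)) // => C.
by rewrite /= card_imset.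
Qed.

Lemma orbit_sizesU1 (T : finType) (C : {set T}) (S : {set {set T}}) :
  C \notin S -> perm_eq (orbit_sizes (C |: S)) (#|C| :: orbit_sizes S).
Proof.
move=> CnS; pose card_set (D : {set T}) := #|D|.
apply: (perm_map card_set (s := enum _) (t := C :: enum S)).
apply: uniq_perm; rewrite /= ?mem_enum ?CnS ?enum_uniq // => D.
by rewrite in_cons !mem_enum !inE.
Qed.

Lemma porbitsJ (T : finType) (s p : {perm T}) :
  porbits (s ^ p)%g = [set p @: C | C : {set T} in porbits s].
Proof.
have orbJ x : porbit (s ^ p)%g (p x) = p @: porbit s x.
  by apply: porbit_imset => y; rewrite permJ.
apply/setP=> D; apply/imsetP/imsetP => [[y _ ->]|[C /imsetP[x _ ->] ->]].
  by exists (porbit s ((p^-1)%g y)); rewrite ?imset_f // -orbJ permKV.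
by exists (p x); rewrite ?orbJ.
Qed.

Lemma cycle_classJ n lambda (s p : 'S_n) :
  ((s ^ p)%g \in cycle_class n lambda) = (s \in cycle_class n lambda).
Proof.
rewrite !inE /has_cycle_type porbitsJ.
by rewrite (permPl (orbit_sizes_imset (porbits s) (@perm_inj _ p))).
Qed.

(** * Adding a fixed point, full cycles and fixed-point counts *)

Lemma porbits_lift_perm n (x : 'I_n.+1) (s : 'S_n) :
  porbits (lift_perm x x s)
    = [set x] |: [set lift x @: C | C : {set 'I_n} in porbits s].
Proof.
have orb_lift y : porbit (lift_perm x x s) (lift x y) = lift x @: porbit s y.
  by apply: porbit_imset => z; rewrite lift_perm_lift.
have orb_x : porbit (lift_perm x x s) x = [set x].
  apply/setP=> y; rewrite inE; apply/porbitP/eqP=> [[i ->]|->]; last first.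
    by exists 0%N; rewrite expg0 perm1.
  elim: i => [|i IHi]; first by rewrite expg0 perm1.
  by rewrite expgSr permM IHi lift_perm_id.
apply/setP=> D; rewrite !inE.
apply/imsetP/orP => [[y _ ->]|[/eqP->|/imsetP[C /imsetP[y _ ->] ->]]].
- case: (unliftP x y) => [z|] ->; last by left; rewrite orb_x.
  by right; rewrite orb_lift; apply/imset_f/imset_f.
- by exists x.
- by exists (lift x y); rewrite ?orb_lift.
Qed.

Lemma cycle_class_lift_perm n lambda lambda' (x : 'I_n.+1) (s : 'S_n) :
  perm_eq lambda' (1%N :: lambda) ->
  (lift_perm x x s \in cycle_class n.+1 lambda') = (s \in cycle_class n lambda).
Proof.
move=> eq_lambda; rewrite !inE /has_cycle_type porbits_lift_perm.
have xnS : [set x] \notin [set lift x @: C | C : {set 'I_n} in porbits s].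
  apply/imsetP=> -[C _ /setP/(_ x)]; rewrite inE eqxx => /esym/imsetP[z _].
  by move/eqP; rewrite (negPf (neq_lift _ _)).
rewrite (permPr eq_lambda) (permPl (orbit_sizesU1 xnS)) cards1 perm_cons.
by rewrite (permPl (orbit_sizes_imset (porbits s) (@lift_inj _ x))).
Qed.

(** Being an n-cycle becomes transitivity, which passes easily through insertions. For [n = 0] there
    are no orbits, whereas [[:: 0]] has one entry. *)
Lemma full_cycleP n (s : 'S_n) : (0 < n)%N ->
  reflect (forall x y, y \in porbit s x) (s \in cycle_class n [:: n]).
Proof.
move=> n_gt0; rewrite inE /has_cycle_type; apply: (iffP idP) => [cyc|trans].
  suff full C : C \in porbits s -> C = setT.
    by move=> x y; rewrite (full (porbit s x)) ?inE //; apply: imset_f.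
  rewrite -mem_enum => CS; apply/eqP; rewrite eqEcard subsetT cardsT card_ord.
  have : #|C| \in orbit_sizes (porbits s) by apply: map_f.
  by rewrite (perm_mem cyc) inE => /eqP->; rewrite leqnn.
suff -> : porbits s = [set setT] by rewrite enum_set1 /= cardsT card_ord.
have fullE x : porbit s x = setT by apply/setP=> y; rewrite trans inE.
apply/setP=> C; rewrite inE; apply/imsetP/eqP=> [[x _ ->]|->].
  exact: fullE.
by exists (Ordinal n_gt0); rewrite ?fullE.
Qed.

(** Fixed points correspond to singleton orbits. Using [count_mem] also covers [n - a = 1], where
    the long part is itself a fixed point. *)
Lemma card_fixed n lambda (s : 'S_n) : s \in cycle_class n lambda ->
  #|[set x | s x == x]| = count_mem 1%N lambda.
Proof.
rewrite inE => /seq.permP<-; rewrite count_map -size_filter.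
rewrite -(card_imset _ (@set1_inj 'I_n)) cardE; apply: perm_size.
apply: uniq_perm; [exact: enum_uniq | exact/filter_uniq/enum_uniq |] => C.
rewrite mem_enum mem_filter mem_enum /=.
apply/imsetP/andP => [[x]|[/cards1P[x ->] /imsetP[y _ Cy]]].
  rewrite inE => /eqP sx ->; rewrite cards1; split=> //.
  apply/imsetP; exists x => //; apply/setP=> y; rewrite inE.
  apply/eqP/porbitP=> [->|[i ->]]; first by exists 0%N; rewrite expg0 perm1.
  by elim: i => [|i IHi]; rewrite ?expg0 ?perm1 // expgSr permM IHi.
exists x => //; rewrite inE; have /setP/(_ y) := Cy.
rewrite porbit_id inE => /eqP xy; rewrite {y}xy in Cy.
by have /setP/(_ (s x)) := Cy; rewrite inE (mem_porbit s 1) => /esym.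
Qed.

(** * Inserting a point into a cycle *)

(* Puts [x] right after [u] in the cycle of [u]: u -> s u becomes
   u -> x -> s u. *)
Definition insert_after n (x : 'I_n.+1) (u : 'I_n) (s : 'S_n) : 'S_n.+1 :=
  (tperm x (lift x u) * lift_perm x x s)%g.

(** Inverse of the insertion on points: the arrow from u to x is contracted, so x is identified with
    u. *)
Definition collapse n (x : 'I_n.+1) (u : 'I_n) (w : 'I_n.+1) : 'I_n :=
  odflt u (unlift x w).

Section Insertion.

Variables (n : nat) (x : 'I_n.+1) (u : 'I_n).

Lemma collapse_id : collapse x u x = u.
Proof. by rewrite /collapse unlift_none. Qed.

Lemma collapse_lift y : collapse x u (lift x y) = y.
Proof. by rewrite /collapse liftK. Qed.

Lemma insert_after_id s : insert_after x u s x = lift x (s u).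
Proof. by rewrite permM tpermL lift_perm_lift. Qed.

Lemma insert_after_lift s y :
  insert_after x u s (lift x y) = if y == u then x else lift x (s y).
Proof.
rewrite permM; case: eqVneq => [->|yu]; first by rewrite tpermR lift_perm_id.
by rewrite tpermD ?neq_lift ?(inj_eq lift_inj) 1?eq_sym // lift_perm_lift.
Qed.

(** Contracting the arrow from u to x turns the cycles of the enlarged permutation into those of
    [s], so orbit membership can be tested after [collapse]. *)
Lemma porbit_insert_after s v w :
  (w \in porbit (insert_after x u s) v)
    = (collapse x u w \in porbit s (collapse x u v)).
Proof.
set t := insert_after x u s.
have mem_next z : t z \in porbit t z by rewrite (mem_porbit t 1).
have lift_collapse z : porbit t (lift x (collapse x u z)) = porbit t z.
  case: (unliftP x z) => [y|] ->; rewrite ?collapse_lift // collapse_id.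
  apply/eqP; rewrite eq_sym eq_porbit_mem.
  by have := mem_next (lift x u); rewrite insert_after_lift eqxx.
apply/idP/idP => [|/(homo_porbit (f := lift x) (t := t))].
  apply: homo_porbit => z; case: (unliftP x z) => [y|] ->.
    rewrite insert_after_lift collapse_lift; case: eqVneq => [->|_].
      by rewrite collapse_id porbit_id.
    by rewrite collapse_lift (mem_porbit s 1).
  by rewrite insert_after_id collapse_id collapse_lift (mem_porbit s 1).
rewrite -!eq_porbit_mem !lift_collapse; apply=> y.
(* At u a single step of [s] is two steps of [t], through x; elsewhere the steps agree. *)
case: (eqVneq y u) => [->|yu]; last first.
  by have := mem_next (lift x y); rewrite insert_after_lift (negPf yu).
rewrite -eq_porbit_mem -[u in eqbRHS]collapse_id lift_collapse eq_porbit_mem.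
by rewrite -insert_after_id mem_next.
Qed.

(** The transposition is the left factor, so multiplying on the right by a permutation fixing x does
    not disturb it: the product inherits the same insertion as alpha. *)
Lemma insert_afterM s t :
  (insert_after x u s * lift_perm x x t = insert_after x u (s * t))%g.
Proof. by rewrite /insert_after -mulgA lift_permM. Qed.

Lemma full_cycle_insert_after s :
  (insert_after x u s \in cycle_class n.+1 [:: n.+1])
    = (s \in cycle_class n [:: n]).
Proof.
have n_gt0 : (0 < n)%N by apply: leq_ltn_trans (ltn_ord u).
apply/full_cycleP/full_cycleP => // cyc v w; rewrite ?porbit_insert_after //.
have := cyc (lift x v) (lift x w).
by rewrite porbit_insert_after !collapse_lift.
Qed.

End Insertion.

Lemma lift_perm_surj n (x : 'I_n.+1) (t : 'S_n.+1) :
  t x = x -> exists s, t = lift_perm x x s.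
Proof.
move=> tx; pose f y := odflt y (unlift x (t (lift x y))).
have liftf y : lift x (f y) = t (lift x y).
  rewrite /f; case: unliftP => [z -> //|]; rewrite -{2}tx => /perm_inj/eqP.
  by rewrite eq_sym (negPf (neq_lift _ _)).
have f_inj : injective f.
  by move=> y z fyz; apply/(@lift_inj _ x)/(@perm_inj _ t); rewrite -!liftf fyz.
exists (perm f_inj); apply/permP=> y.
case: (unliftP x y) => [z|] ->; last by rewrite lift_perm_id.
by rewrite lift_perm_lift permE liftf.
Qed.

Lemma lift_perm_inj n (x : 'I_n.+1) : injective (lift_perm x x).
Proof.
move=> s t st; apply/permP=> y; apply: (@lift_inj _ x).
by rewrite -!(lift_perm_lift x x) st.
Qed.

Lemma insert_after_inj n (x : 'I_n.+1) (u u' : 'I_n) (s s' : 'S_n) :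
  insert_after x u s = insert_after x u' s' -> u = u' /\ s = s'.
Proof.
move=> eq_ins; suff uu' : u = u'.
  by split=> //; move: eq_ins; rewrite -uu' => /mulgI/lift_perm_inj.
have := insert_after_lift x u s u; rewrite eqxx eq_ins insert_after_lift.
by case: eqVneq => // _ /eqP; rewrite eq_sym (negPf (neq_lift _ _)).
Qed.

(** The point u is the preimage of x under [t]; composing with the transposition of the two makes x
    fixed. *)
Lemma insert_after_surj n (x : 'I_n.+1) (t : 'S_n.+1) :
  t x != x -> exists u s, t = insert_after x u s.
Proof.
move=> tx; have : (t^-1)%g x != x by rewrite (canF_eq (permKV t)) eq_sym.
case: (unliftP x ((t^-1)%g x)) => [u Du _|->]; last by rewrite eqxx.
have fix_x : (tperm x (lift x u) * t)%g x = x.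
  by rewrite permM tpermL -Du permKV.
have [s Ds] := lift_perm_surj fix_x.
by exists u, s; rewrite /insert_after -Ds mulgA tperm2 mul1g.
Qed.

Lemma full_cycle_moves n (x : 'I_n.+1) (t : 'S_n.+1) :
  (0 < n)%N -> t \in cycle_class n.+1 [:: n.+1] -> t x != x.
Proof.
move=> n_gt0 /(full_cycleP _ (ltn0Sn n)) cyc; apply/eqP=> tx.
have /porbitP[i] := cyc x (lift x (Ordinal n_gt0)).
suff -> : (t ^+ i)%g x = x by move/eqP; rewrite eq_sym (negPf (neq_lift _ _)).
by elim: i => [|i IHi]; rewrite ?expg0 ?perm1 // expgSr permM IHi.
Qed.

(** * Double counting of pairs with a marked fixed point *)

Section PairCount.

Definition cycle_pairs (n a : nat) : {set 'S_n * 'S_n} :=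
  setX (cycle_class n [:: n]) (cycle_class n ((n - a)%N :: nseq a 1%N)).

Variables n a : nat.
Hypothesis lt_an : (a < n)%N.

(** Deleting x is a bijection: alpha moves x, hence is an insertion after a unique u, while beta
    fixes x, hence is a lift. *)
Lemma card_pairs_fixing (Q : pred 'S_n.+1) (x : 'I_n.+1) :
  #|[set v in cycle_pairs n.+1 a.+1 | (v.2 x == x) && Q (v.1 * v.2)%g]|
    = (\sum_(u < n)
        #|[set v in cycle_pairs n a | Q (insert_after x u (v.1 * v.2)%g)]|)%N.
Proof.
pose f (t : 'I_n * ('S_n * 'S_n)) : 'S_n.+1 * 'S_n.+1 :=
  (insert_after x t.1 t.2.1, lift_perm x x t.2.2).
have f_inj : injective f.
  move=> [u [s t]] [u' [s' t']] [/insert_after_inj[/= -> ->]].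
  by move/lift_perm_inj->.
pose D := [set t : 'I_n * ('S_n * 'S_n) |
  (t.2 \in cycle_pairs n a) && Q (insert_after x t.1 (t.2.1 * t.2.2)%g)].
have lambdaE : perm_eq ((n.+1 - a.+1)%N :: nseq a.+1 1%N)
                 (1%N :: ((n - a)%N :: nseq a 1%N)).
  rewrite subSS -cat1s -[1%N :: (_ :: _)]/([:: 1%N; (n - a)%N] ++ _).
  rewrite -[nseq a.+1 1%N]/([:: 1%N] ++ nseq a 1%N) catA perm_cat2r.
  by rewrite (perm_catC [:: _]).
have memf t : (f t \in cycle_pairs n.+1 a.+1) = (t.2 \in cycle_pairs n a).
  by case: t => u [s t]; rewrite !in_setX full_cycle_insert_after
    (cycle_class_lift_perm _ _ lambdaE).
transitivity #|f @: D|.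
  apply: eq_card => -[s t]; rewrite inE /=; apply/andP/imsetP.
    case=> st /andP[/eqP tx Qst].
    have [t' Dt'] := lift_perm_surj tx.
    have sx : s x != x.
      apply: full_cycle_moves; first by apply: leq_ltn_trans lt_an.
      by move: st; rewrite in_setX => /andP[].
    have [u [s' Ds']] := insert_after_surj sx.
    exists (u, (s', t')); last by rewrite Ds' Dt'.
    by rewrite inE -memf /f /= -Ds' -Dt' st -insert_afterM -Ds' -Dt'.
  case=> t' ; rewrite inE => /andP[t'P Qt'] Dst.
  rewrite Dst memf t'P; split=> //.
  by move: Dst; rewrite /f => -[-> ->]; rewrite lift_perm_id eqxx insert_afterM.
rewrite (card_imset _ f_inj) -sum1dep_card.
rewrite (eq_bigr (fun u => \sum_(v | (v \in cycle_pairs n a) &&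
   Q (insert_after x u (v.1 * v.2)%g)) 1)%N); first by rewrite pair_big_dep.
by move=> u _; rewrite sum1dep_card.
Qed.

(** Summing over x counts each pair once for every fixed point of beta, a number determined by its
    cycle type. *)
Lemma sum_pairs_fixing (Q : pred 'S_n.+1) :
  (#|[set v in cycle_pairs n.+1 a.+1 | Q (v.1 * v.2)%g]|
     * count_mem 1%N ((n - a)%N :: nseq a.+1 1%N)
   = \sum_(x < n.+1) \sum_(u < n)
        #|[set v in cycle_pairs n a | Q (insert_after x u (v.1 * v.2)%g)]|)%N.
Proof.
move def_f: (count_mem _ _) => f.
under eq_bigr do rewrite -card_pairs_fixing -sum1dep_card.
rewrite (exchange_big_dep
  (fun v => (v \in cycle_pairs n.+1 a.+1) && Q (v.1 * v.2)%g)) /=; last first.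
  by move=> x v _ /and3P[-> _ ->].
rewrite -sum1dep_card big_distrl /=; apply: eq_bigr => v /andP[vP Qv].
rewrite vP Qv mul1n sum1dep_card.
have /card_fixed : v.2 \in cycle_class n.+1 ((n.+1 - a.+1)%N :: nseq a.+1 1%N).
  by case: (v) vP => s t; rewrite in_setX => /andP[].
by rewrite subSS def_f => <-; apply: eq_card => x; rewrite !inE andbT.
Qed.

Lemma card_cycle_pairsS :
  (#|cycle_pairs n.+1 a.+1| * count_mem 1%N ((n - a)%N :: nseq a.+1 1%N)
   = n.+1 * n * #|cycle_pairs n a|)%N.
Proof.
have cardT m b (Q : pred ('S_m * 'S_m)) : Q =1 predT ->
    #|[set v in cycle_pairs m b | Q v]| = #|cycle_pairs m b|.
  by move=> QT; apply: eq_card => v; rewrite inE QT andbT.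
have := sum_pairs_fixing predT; rewrite cardT // => ->.
under eq_bigr do under eq_bigr do rewrite cardT //.
by rewrite !sum_nat_const !card_ord mulnA.
Qed.

End PairCount.

(** * Colourings matched by cycles *)

(* [b] is a blank colour: the points of colour [b] are unconstrained.  Strong
   I-separation is the case of the colouring [reshape_index I], which sends the
   points of the block [p] to [p] and those outside all blocks to [size I]. *)
Definition cycles_match n (b : nat) (c : 'I_n -> nat) (s : 'S_n) : bool :=
  [forall x, forall y, (c x != b) && (c y != b) ==>
     ((y \in porbit s x) == (c x == c y))].

Lemma cycles_matchP n b (c : 'I_n -> nat) s :
  reflect (forall x y, c x != b -> c y != b ->
             (y \in porbit s x) = (c x == c y))
          (cycles_match b c s).
Proof.
apply: (iffP forallP) => [match_c x y cx cy|match_c x].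
  by have /forallP/(_ y) := match_c x; rewrite cx cy => /eqP.
by apply/forallP=> y; apply/implyP=> /andP[cx cy]; rewrite match_c.
Qed.

(** The hypotheses say that [collapse] maps the non-blank points of [c] onto those of [d] and keeps
    their colours. It need not be injective there: x and u may share a colour. *)
Lemma cycles_match_insert_after n b (c : 'I_n.+1 -> nat) (d : 'I_n -> nat)
    x u s :
  (forall w, c w != b -> d (collapse x u w) = c w) ->
  (forall z, d z != b -> exists2 w, collapse x u w = z & c w != b) ->
  cycles_match b c (insert_after x u s) = cycles_match b d s.
Proof.
move=> dc cd.
apply/cycles_matchP/cycles_matchP => [match_c y z|match_d v w cv cw].
  move=> /cd[v <- cv] /cd[w <- cw].
  by rewrite -porbit_insert_after match_c // !dc.
by rewrite porbit_insert_after match_d !dc.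
Qed.

Definition color_count n (c : 'I_n -> nat) (j : nat) : nat :=
  (\sum_(x < n) (c x == j))%N.

Lemma color_count_lift n (c : 'I_n.+1 -> nat) x j :
  color_count c j = ((c x == j) + color_count (c \o lift x) j)%N.
Proof. exact: bigD1_ord. Qed.

(** Equal multiplicities make the two lists of colours rearrangements of each other. *)
Lemma eq_color_count n (c d : 'I_n -> nat) :
  color_count c =1 color_count d -> exists p : 'S_n, forall x, c x = d (p x).
Proof.
move=> eq_cd.
have : perm_eq (map c (enum 'I_n)) (map d (enum 'I_n)).
  apply/allP=> j _; apply/eqP; rewrite /= (count_map c) (count_map d).
  have countE (e : 'I_n -> nat) :
      count (preim e (pred1 j)) (enum 'I_n) = color_count e j.
    rewrite -sum1_count big_enum_cond big_mkcond; apply: eq_bigr => x _ /=.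
    by case: eqP.
  by rewrite !countE.
rewrite -[X in perm_eq _ (map d X)](val_ord_tuple n).
case/(@tuple_permP _ _ _ (map_tuple d (ord_tuple n)))=> p Dp; exists p => x.
have := congr1 (fun s => nth 0%N s x) Dp.
rewrite (nth_map x) ?size_enum_ord // nth_ord_enum => ->.
rewrite (nth_map x) -?enumT ?size_enum_ord // nth_ord_enum.
by rewrite tnth_map tnth_ord_tuple.
Qed.

Lemma cycles_matchJ n b (c : 'I_n -> nat) (s p : 'S_n) :
  cycles_match b c (s ^ p)%g = cycles_match b (c \o p) s.
Proof.
have orbJ x y : (p y \in porbit (s ^ p)%g (p x)) = (y \in porbit s x).
  rewrite (porbit_imset (s := s)) => [|z]; last by rewrite permJ.
  by rewrite mem_imset //; apply: perm_inj.
apply/cycles_matchP/cycles_matchP => match_c x y cx cy.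
  by rewrite -orbJ match_c.
by rewrite -[x](permKV p) -[y](permKV p) orbJ match_c //= permKV.
Qed.

Definition match_count n a b (c : 'I_n -> nat) : nat :=
  #|[set v in cycle_pairs n a | cycles_match b c (v.1 * v.2)%g]|.

(** Conjugating both factors by one permutation conjugates the product and preserves both cycle
    classes, so only the size of each colour class matters. *)
Lemma eq_match_count n a b (c d : 'I_n -> nat) :
  color_count c =1 color_count d -> match_count a b c = match_count a b d.
Proof.
move=> /eq_color_count[p cd].
pose f (v : 'S_n * 'S_n) := ((v.1 ^ p)%g, (v.2 ^ p)%g).
have f_inj : injective f by move=> [s t] [s' t'] [/conjg_inj-> /conjg_inj->].
rewrite /match_count -!sum1dep_card [RHS](reindex_inj f_inj) /=.
apply: eq_bigl => -[s t].
rewrite -conjMg cycles_matchJ !in_setX /= !cycle_classJ; congr (_ && _).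
apply/cycles_matchP/cycles_matchP => match_c x y.
  by rewrite /= -!cd; apply: match_c.
by rewrite !cd; apply: match_c.
Qed.

(** * The colouring of a composition and strong separation *)

Lemma reshape_index_cons i I x :
  reshape_index (i :: I) x
    = if (x < i)%N then 0%N else (reshape_index I (x - i)).+1.
Proof.
rewrite /reshape_index /= subn_eq0; case: ltnP => // ix.
by rewrite subSn.
Qed.

Lemma reshape_index_le I x : (reshape_index I x <= size I)%N.
Proof. by rewrite /reshape_index (leq_trans (find_size _ _)) ?size_scanl. Qed.

Lemma reshape_index_eq I p x : (p < size I)%N ->
  (reshape_index I x == p) = (sumn (take p I) <= x < sumn (take p.+1 I))%N.
Proof.
elim: I p x => [|i I IHI] [|p] x //= pI; rewrite reshape_index_cons.
  by rewrite take0 addn0; case: ltnP.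
case: ltnP => [xi|ix].
  by symmetry; apply/negbTE; rewrite negb_and -ltnNge (leq_trans xi) ?leq_addr.
by rewrite eqSS IHI // leq_subRL // ltn_subLR.
Qed.

Lemma mem_block n I p (x : 'I_n) : (p < size I)%N ->
  (x \in block n I p) = (reshape_index I x == p).
Proof. by move=> pI; rewrite inE reshape_index_eq. Qed.

Lemma color_count_reshape_index n I j : (sumn I <= n)%N ->
  color_count (fun x : 'I_n => reshape_index I x) j
    = nth 0%N (rcons I (n - sumn I)%N) j.
Proof.
elim: I n j => [|i I IHI] n j /=; rewrite /color_count.
  move=> _; rewrite subn0 (eq_bigr (fun=> nat_of_bool (0 == j)%N)) //.
  rewrite sum_nat_const card_ord.
  by case: j => [|[|j]]; rewrite /= ?muln1 ?muln0.
move=> le_n; have /subnKC Dn : (i <= n)%N.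
  by apply: leq_trans le_n; apply: leq_addr.
rewrite -Dn big_split_ord /=.
rewrite (eq_bigr (fun=> nat_of_bool (0 == j)%N)); last first.
  by move=> x _; rewrite reshape_index_cons ltn_ord.
rewrite sum_nat_const card_ord.
rewrite (eq_bigr (fun x : 'I_(n - i)%N =>
  nat_of_bool ((reshape_index I x).+1 == j))); last first.
  by move=> x _; rewrite reshape_index_cons ltnNge leq_addr addKn.
rewrite subnDl; case: j => [|j] /=; first by rewrite muln1 big1 ?addn0.
by rewrite muln0 add0n -IHI // leq_subRL ?Dn // -Dn leq_addr.
Qed.

(** Separation says that points of one cycle share their colour; containment of blocks in cycles
    says that points of one colour share their cycle. *)
Lemma strongly_separatedE n I (s : 'S_n) :
  all (leq 1) I -> (sumn I <= n)%N ->
  strongly_separated I s = cycles_match (size I) (fun x => reshape_index I x) s.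
Proof.
move=> /all_nthP I_gt0 le_n.
have lt_size (x : 'I_n) :
    reshape_index I x != size I -> (reshape_index I x < size I)%N.
  by move=> x_sz; rewrite ltn_neqAle x_sz reshape_index_le.
apply/andP/cycles_matchP => [[/forall_inP sep /forallP ssep] x y cx cy|match_c].
  have [cx_lt cy_lt] := (lt_size _ cx, lt_size _ cy).
  apply/idP/eqP => [xy|cxy].
    have /sep/forallP/(_ (Ordinal cx_lt))/forallP/(_ (Ordinal cy_lt)) :
      porbit s x \in porbits s by apply: imset_f.
    move/implyP=> eq_xy; suff /eq_xy/eqP[] :
      (porbit s x :&: block n I (Ordinal cx_lt) != set0)
        && (porbit s x :&: block n I (Ordinal cy_lt) != set0) by [].
    apply/andP; split; apply/set0Pn.
      by exists x; rewrite !inE porbit_id -reshape_index_eq ?eqxx.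
    by exists y; rewrite !inE xy -reshape_index_eq ?eqxx.
  have /exists_inP[_ /imsetP[z _ ->] /subsetP sub] := ssep (Ordinal cx_lt).
  have /sub : x \in block n I (Ordinal cx_lt) by rewrite mem_block.
  have /sub : y \in block n I (Ordinal cx_lt) by rewrite mem_block //= cxy.
  by rewrite -!eq_porbit_mem => /eqP-> /eqP->.
split.
  apply/forall_inP=> _ /imsetP[z _ ->]; apply/forallP=> p; apply/forallP=> q.
  apply/implyP=> /andP[/set0Pn[x /setIP[zx]] + /set0Pn[y /setIP[zy]]].
  rewrite !mem_block // => /eqP xp /eqP yq.
  have := match_c x y; rewrite xp yq !neq_ltn !ltn_ord => /(_ isT isT) Exy.
  rewrite -val_eqE /= -Exy.
  by move: zx zy; rewrite -!eq_porbit_mem => /eqP-> /eqP->.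
apply/forallP=> p.
(* Positive parts make the block nonempty; the cycle of any of its points is the witness. *)
have [x xp] : exists x : 'I_n, reshape_index I x == p.
  have := color_count_reshape_index p le_n; rewrite nth_rcons ltn_ord.
  have := I_gt0 0%N p (ltn_ord p); rewrite /color_count => + Dp; rewrite -{}Dp.
  by rewrite lt0n sum_nat_eq0 => /forallPn[x]; rewrite eqb0 negbK; exists x.
apply/exists_inP; exists (porbit s x); first exact: imset_f.
apply/subsetP=> y; rewrite mem_block // => yp.
by rewrite match_c ?(eqP xp) ?(eqP yp) // neq_ltn ltn_ord.
Qed.

Definition strong_count n a (I : seq nat) : nat :=
  #|[set v in cycle_pairs n a | strongly_separated I (v.1 * v.2)%g]|.

Lemma match_count_strong n a I (c : 'I_n -> nat) :
  all (leq 1) I -> (sumn I <= n)%N ->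
  (forall j, color_count c j = nth 0%N (rcons I (n - sumn I)%N) j) ->
  match_count a (size I) c = strong_count n a I.
Proof.
move=> I_gt0 le_n countc.
rewrite (@eq_match_count _ _ _ _ (fun x => reshape_index I x)); last first.
  by move=> j; rewrite countc color_count_reshape_index.
by apply: eq_card => v; rewrite !inE strongly_separatedE.
Qed.

(** * Counting insertions by the colours of x and u *)

Section Recurrence.

Variables (n a : nat) (I : seq nat).
Hypotheses (I_gt0 : all (leq 1) I) (le_n : (sumn I <= n)%N).

Let c (x : 'I_n.+1) := reshape_index I x.
Let insert_count x u : nat :=
  #|[set v in cycle_pairs n a |
      strongly_separated I (insert_after x u (v.1 * v.2)%g)]|.

Let countc j : color_count c j = nth 0%N (rcons I (n.+1 - sumn I)%N) j.
Proof. by apply: color_count_reshape_index; apply: leqW. Qed.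

Let count_lift x j :
  color_count (c \o lift x) j
    = (nth 0%N (rcons I (n.+1 - sumn I)%N) j - (c x == j))%N.
Proof. by rewrite -countc (color_count_lift _ x) addKn. Qed.

Let insert_count_match x u (d : 'I_n -> nat) :
  (forall w, c w != size I -> d (collapse x u w) = c w) ->
  (forall z, d z != size I -> exists2 w, collapse x u w = z & c w != size I) ->
  insert_count x u = match_count a (size I) d.
Proof.
move=> dc cd; apply: eq_card => v.
rewrite !inE strongly_separatedE //; last exact: leqW.
by rewrite (cycles_match_insert_after _ dc cd).
Qed.

Lemma insert_count_blank x u : c x = size I ->
  insert_count x u = strong_count n a I.
Proof.
move=> cx; rewrite (@insert_count_match _ _ (c \o lift x)).
- apply: match_count_strong => // j; rewrite count_lift cx !nth_rcons.
  case: (ltngtP j (size I)) => [jI|//|_]; last by rewrite subSn // subn1.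
  by rewrite subn0.
- move=> w; case: (unliftP x w) => [y|] ->; first by rewrite collapse_lift.
  by rewrite cx eqxx.
- by move=> z cz; exists (lift x z); rewrite ?collapse_lift.
Qed.

(** Since x automatically joins the cycle of u, the constraint on x is redundant and the block
    simply loses a point. *)
Lemma insert_count_same x u : c x != size I -> c (lift x u) = c x ->
  insert_count x u = strong_count n a (decr_part I (c x)).
Proof.
move=> cx cu; rewrite (@insert_count_match _ _ (c \o lift x)); first last.
- by move=> z cz; exists (lift x z); rewrite ?collapse_lift.
- move=> w; case: (unliftP x w) => [y|] ->; first by rewrite collapse_lift.
  by rewrite collapse_id /= cu.
have cx_lt : (c x < size I)%N by rewrite ltn_neqAle cx reshape_index_le.
(* The point u keeps this colour after the deletion of x, so the part is at least 2 and [decr_part]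
   is again a composition. *)
have : (0 < color_count (c \o lift x) (c x))%N.
  by rewrite /color_count (bigD1 u) //= cu eqxx.
rewrite count_lift nth_rcons cx_lt eqxx subn_gt0 => Ix_gt1.
have sum_gt0 : (0 < sumn I)%N.
  rewrite sumnE (big_nth 0%N) big_mkord (bigD1 (Ordinal cx_lt)) //=.
  by rewrite ltn_addr // ltnW.
have size_decr : size (decr_part I (c x)) = size I.
  by rewrite size_set_nth; apply/maxn_idPr.
have sum_decr : sumn (decr_part I (c x)) = (sumn I).-1.
  rewrite sumn_set_nth_ltn //; case: (nth _ _ _) Ix_gt1 => // k _.
  by rewrite /= -[k.+1]add1n subnDr subn1.
rewrite -size_decr match_count_strong //.
- apply/(all_nthP 0%N) => i; rewrite size_decr nth_set_nth /= => iI.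
  case: eqP => _; last exact: (all_nthP _ I_gt0).
  by rewrite -ltnS prednK // ltnW.
- by rewrite sum_decr; apply: leq_trans le_n; apply: leq_pred.
- move=> j; rewrite count_lift !nth_rcons size_decr sum_decr nth_set_nth /=.
  case: (eqVneq (c x) j) => [<-|cxj]; first by rewrite cx_lt subn1.
  rewrite subn0; case: ltngtP => // _.
  by rewrite -subn1 subnBA // addn1.
Qed.

(** The unconstrained point u inherits the colour of x, so every block keeps its size and one blank
    point disappears. *)
Lemma insert_count_new x u : c x != size I -> c (lift x u) = size I ->
  insert_count x u = strong_count n a I.
Proof.
move=> cx cu; pose d z := if z == u then c x else c (lift x z).
rewrite (@insert_count_match _ _ d); first last.
- rewrite /d => z; case: (eqVneq z u) => [-> _|_ cz].
    by exists x; rewrite ?collapse_id.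
  by exists (lift x z); rewrite ?collapse_lift.
- move=> w; case: (unliftP x w) => [y|] ->; last by rewrite collapse_id /d eqxx.
  rewrite collapse_lift /d; case: (eqVneq y u) => // ->.
  by rewrite cu eqxx.
(* Adding the lost blank point to the counts of [d] gives those of [c], which avoids truncated
   subtraction. *)
apply: match_count_strong => // j; apply: (@addnI (size I == j)).
have -> : ((size I == j) + color_count d j = color_count c j)%N.
  rewrite (color_count_lift _ x) /color_count.
  rewrite (bigD1 u) //= [in RHS](bigD1 u) //=.
  rewrite {1}/d eqxx cu addnCA; congr (_ + (_ + _))%N.
  by apply: eq_bigr => z /negPf zu; rewrite /d zu.
rewrite countc !nth_rcons; case: ltngtP => // _.
by rewrite add1n subSn.
Qed.

Lemma insert_count_clash x u : c x != size I -> c (lift x u) != size I ->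
  c (lift x u) != c x -> insert_count x u = 0%N.
Proof.
move=> cx cu cux; apply: eq_card0 => v; rewrite !inE.
rewrite strongly_separatedE //; last exact: leqW.
apply/negP=> /andP[_ /cycles_matchP/(_ _ _ cu cx)].
by rewrite porbit_insert_after collapse_id collapse_lift porbit_id (negPf cux).
Qed.

(** Rows x are grouped by colour. A part equal to 1 gives a zero factor, so the zero part in its
    [decr_part] is harmless. *)
Lemma sum_insert_count :
  (\sum_x \sum_u insert_count x u
   = (n.+1 - sumn I) * (n + sumn I) * strong_count n a I
     + \sum_(h < size I)
         nth 0 I h * (nth 0 I h - 1) * strong_count n a (decr_part I h))%N.
Proof.
set N := strong_count n a I.
pose N' h := strong_count n a (decr_part I h).
have row_blank x : c x = size I -> (\sum_u insert_count x u = n * N)%N.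
  move=> cx; under eq_bigr do rewrite (insert_count_blank _ cx).
  by rewrite sum_nat_const card_ord.
have row x : (c x < size I)%N -> (\sum_u insert_count x u
    = (nth 0 I (c x) - 1) * N' (c x) + (n.+1 - sumn I) * N)%N.
  move=> cx_lt; have cx : c x != size I by rewrite neq_ltn cx_lt.
  (* Only u of the colour of x or blank contribute; a clash gives 0. *)
  transitivity (\sum_u ((c (lift x u) == c x) * N' (c x)
                        + (c (lift x u) == size I) * N))%N.
    apply: eq_bigr => u _; case: (eqVneq (c (lift x u)) (c x)) => [cu|cux].
      by rewrite (insert_count_same cx cu) cu (negPf cx) mul1n addn0.
    case: eqVneq => [cu|cu]; first by rewrite (insert_count_new cx cu) mul1n.
    by rewrite insert_count_clash.
  rewrite big_split -!big_distrl /=.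
  rewrite -[X in (X * _ + _)%N]/(color_count (c \o lift x) (c x)).
  rewrite -[X in (_ + X * _)%N]/(color_count (c \o lift x) (size I)).
  by rewrite !count_lift !nth_rcons cx_lt ltnn !eqxx (negPf cx) subn0.
have le_c x : (c x < (size I).+1)%N by rewrite ltnS reshape_index_le.
rewrite (partition_big (fun x => Ordinal (le_c x)) predT) //= big_ord_recr /=.
have fiber (j : 'I_(size I).+1) (F : nat) :
    (\sum_(x | Ordinal (le_c x) == j) F
     = nth 0 (rcons I (n.+1 - sumn I)) j * F)%N.
  rewrite -countc /color_count big_distrl big_mkcond /=; apply: eq_bigr => x _.
  by rewrite -(inj_eq val_inj) /=; case: eqP; rewrite ?mul1n.
rewrite [X in (_ + X)%N](eq_bigr (fun=> n * N)%N); last first.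
  by move=> x /eqP[/row_blank].
rewrite fiber nth_rcons ltnn eqxx.
rewrite (eq_bigr (fun h : 'I_(size I) => nth 0 I h * (nth 0 I h - 1) * N' h
                   + nth 0 I h * ((n.+1 - sumn I) * N))%N); last first.
  move=> h _; rewrite (eq_bigr
    (fun=> (nth 0 I h - 1) * N' h + (n.+1 - sumn I) * N)%N).
    by rewrite fiber /= nth_rcons ltn_ord mulnDr mulnA.
  by move=> x /eqP[cx]; rewrite row cx.
rewrite big_split /= -big_distrl /=.
rewrite -[X in (_ + X * _ + _)%N](big_mkord xpredT (nth 0%N I)).
rewrite -(big_nth 0%N xpredT id) -sumnE.
(* With m = [sumn I], the blank rows give (n+1-m)n and the others m(n+1-m) copies of [N], in total
   (n+1-m)(n+m). *)
by rewrite -addnA addnC; congr (_ + _)%N; ring.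
Qed.

End Recurrence.

(** * From counts to probabilities *)

Lemma strong_count_recurrence n a I :
  (a < n)%N -> all (leq 1) I -> (sumn I <= n)%N ->
  (strong_count n.+1 a.+1 I * count_mem 1 ((n - a) :: nseq a.+1 1)
   = (n.+1 - sumn I) * (n + sumn I) * strong_count n a I
     + \sum_(h < size I)
         nth 0 I h * (nth 0 I h - 1) * strong_count n a (decr_part I h))%N.
Proof.
move=> lt_an I_gt0 le_n; rewrite -sum_insert_count //.
exact: sum_pairs_fixing.
Qed.

Unset Implicit Arguments.

Theorem theorem5p6 (m n a : nat) (I : seq nat)
    (m_gt0 : (0 < m)%N) (I_comp : composition_of m I)
    (le_mn : (m <= n)%N) (lt_an : (a < n)%N) :
  n%:R * (n%:R + 1) * prob_strongly_separated n.+1 a.+1 I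
  = (n%:R - m%:R + 1) * (n%:R + m%:R) * prob_strongly_separated n a I
    + \sum_(h < size I)
        (nth 0%N I h)%:R * ((nth 0%N I h)%:R - 1)
        * prob_strongly_separated n a (decr_part I h).
Proof.
move: I_comp => /andP[I_gt0 /eqP Dm].
have probE k b J : prob_strongly_separated k b J
  = (strong_count k b J)%:R / #|cycle_pairs k b|%:R by [].
have := card_cycle_pairsS lt_an.
have := strong_count_recurrence lt_an I_gt0; rewrite Dm => /(_ le_mn).
have : (0 < count_mem 1 ((n - a) :: nseq a.+1 1))%N.
  by rewrite -has_count /= orbT.
move: (count_mem _ _) => f f_gt0 recN recP.
have f_neq0 : f%:R != 0 :> rat by rewrite pnatr_eq0 -lt0n.
have n_gt0 : (0 < n)%N by apply: leq_trans m_gt0 le_mn.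
have nat_neq0 k : (0 < k)%N -> k%:R != 0 :> rat by rewrite pnatr_eq0 -lt0n.
(* By [recP] both probabilities can be put over the denominator [#|cycle_pairs n a|], and the factor
   [f] appears as in [recN]. *)
have -> : n%:R * (n%:R + 1) * prob_strongly_separated n.+1 a.+1 I
    = (strong_count n.+1 a.+1 I * f)%:R / #|cycle_pairs n a|%:R.
  rewrite probE; have := congr1 (fun k => k%:R : rat) recP.
  (* If this set is empty, [recP] makes the larger one empty too, and both sides vanish because
     division by 0 gives 0. *)
  have [P0|P_gt0] := posnP #|cycle_pairs n a|.
    rewrite P0 muln0 => /eqP; rewrite pnatr_eq0 muln_eq0.
    by rewrite (gtn_eqF f_gt0) orbF => /eqP->; rewrite invr0 !mulr0.
  have n_neq0 := nat_neq0 _ n_gt0; have P_neq0 := nat_neq0 _ P_gt0.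
  have := nat_neq0 _ (ltn0Sn n); rewrite !natrM -natr1 => S_neq0 eqP.
  have P'_neq0 : #|cycle_pairs n.+1 a.+1|%:R != 0 :> rat.
    have : (n%:R + 1) * n%:R * #|cycle_pairs n a|%:R != 0 :> rat.
      by rewrite !mulf_neq0.
    by rewrite -eqP mulf_eq0 negb_or => /andP[].
  have -> : #|cycle_pairs n a|%:R =
      #|cycle_pairs n.+1 a.+1|%:R * f%:R / ((n%:R + 1) * n%:R) :> rat.
    by rewrite eqP; field; rewrite n_neq0.
  by field; rewrite f_neq0 n_neq0 S_neq0 P'_neq0.
rewrite recN natrD mulrDl !natrM natrB ?(leqW le_mn) // natrD -natr1.
congr (_ + _); first by rewrite probE mulrA; congr (_ * _ * _ * _); ring.
rewrite natr_sum big_distrl /=; apply: eq_bigr => h _; rewrite probE.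
(* Positivity of the part lets the truncated [i_h - 1] become the rational difference. *)
rewrite !natrM natrB ?mulrA //.
exact: (all_nthP _ I_gt0).
Qed.
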